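(* There is no algorithm that, given a finite set $\Sigma$ of sp-implications, decides whether the spi-logic $\mathsf{SPi}+\Sigma$ is complete. Likewise, there is no algorithm that, given a finite set $\Sigma$ of sp-implications, decides whether $\mathsf{SPi}+\Sigma$ is complex.
   Context: Signatures are sets $\mathcal R$ of relation symbols with diamonds $\Diamond_R$ (multimodal; the sets $\Sigma$ may use any finitely many diamonds). Sp-formulas: built from propositional variables and $\top$ by $\wedge$ and the $\Diamond_R$; sp-implications $\sigma\to\tau$. A SLO is an algebra $(A,\wedge,\top,\Diamond_R)_R$ with $(A,\wedge,\top)$ a meet-semilattice with top and each $\Diamond_R$ monotone; it validates $\sigma\to\tau$ if $\sigma[\mathfrak a]\le\tau[\mathfrak a]$ for all valuations. Frames $(W,R^{\mathfrak F})_R$ with standard Kripke semantics. $\Sigma\models_{\mathsf{Kr}}\iota$ (resp. $\models_{\mathsf{SLO}}$): $\iota$ valid in every frame (resp. SLO) validating $\Sigma$. The spi-logic $\mathsf{SPi}+\Sigma=\{\iota\mid\Sigma\models_{\mathsf{SLO}}\iota\}$ is complete if $\Sigma\models_{\mathsf{Kr}}\iota\iff\Sigma\models_{\mathsf{SLO}}\iota$ for all sp-implications $\iota$. For a frame $\mathfrak F$, $\mathfrak F^\star=(2^W,\cap,W,\Diamond_R^+)_R$ with $\Diamond_R^+X=\{w\mid\exists v\in X,(w,v)\in R^{\mathfrak F}\}$; a spi-logic $L$ is complex if every SLO validating $L$ embeds (injectively, preserving $\wedge,\top,\Diamond_R$) into $\mathfrak F^\star$ for some frame $\mathfrak F$ validating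 $L$. *)

(* Defs.v *)
From HB Require Import structures.
From mathcomp Require Import all_boot.

Set Implicit Arguments.
Unset Strict Implicit.
Unset Printing Implicit Defensive.

Inductive spf : Type :=
| SVar : nat -> spf
| STop : spf
| SAnd : spf -> spf -> spf
| SDia : nat -> spf -> spf.

(* an sp-implication  sigma -> tau  *)
Definition spi : Type := (spf * spf)%type.

Fixpoint spf_to_tree (f : spf) : GenTree.tree nat :=
  match f with
  | SVar n => GenTree.Node 0 [:: GenTree.Leaf n]
  | STop => GenTree.Node 1 [::]
  | SAnd a b => GenTree.Node 2 [:: spf_to_tree a; spf_to_tree b]
  | SDia r a => GenTree.Node 3 [:: GenTree.Leaf r; spf_to_tree a]
  end.

Fixpoint spf_of_tree (t : GenTree.tree nat) : option spf :=
  match t with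
  | GenTree.Node 0 [:: GenTree.Leaf n] => Some (SVar n)
  | GenTree.Node 1 [::] => Some STop
  | GenTree.Node 2 [:: a; b] =>
      match spf_of_tree a, spf_of_tree b with
      | Some x, Some y => Some (SAnd x y)
      | _, _ => None
      end
  | GenTree.Node 3 [:: GenTree.Leaf r; a] => omap (SDia r) (spf_of_tree a)
  | _ => None
  end.

Lemma spf_treeK : pcancel spf_to_tree spf_of_tree.
Proof. by elim=> //= [a -> b ->|r a ->]. Qed.

HB.instance Definition _ := Equality.copy spf (pcan_type spf_treeK).
HB.instance Definition _ := Choice.copy spf (pcan_type spf_treeK).
HB.instance Definition _ := Countable.copy spf (pcan_type spf_treeK).

Record SLO : Type := {
  slo_car : Type;
  slo_meet : slo_car -> slo_car -> slo_car;
  slo_top : slo_car;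
  slo_dia : nat -> slo_car -> slo_car;
  slo_meetA : forall x y z, slo_meet x (slo_meet y z) = slo_meet (slo_meet x y) z;
  slo_meetC : forall x y, slo_meet x y = slo_meet y x;
  slo_meetxx : forall x, slo_meet x x = x;
  slo_meetT : forall x, slo_meet x slo_top = x;
  slo_dia_mono : forall r x y,
      slo_meet x y = x -> slo_meet (slo_dia r x) (slo_dia r y) = slo_dia r x
}.

Definition slo_le (A : SLO) (x y : slo_car A) : Prop := slo_meet x y = x.

Fixpoint slo_eval (A : SLO) (v : nat -> slo_car A) (f : spf) : slo_car A :=
  match f with
  | SVar n => v n
  | STop => slo_top A
  | SAnd a b => slo_meet (slo_eval v a) (slo_eval v b)
  | SDia r a => slo_dia r (slo_eval v a)
  end.

Definition slo_valid (A : SLO) (i : spi) : Prop :=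
  forall v : nat -> slo_car A, slo_le (slo_eval v i.1) (slo_eval v i.2).

Definition slo_conseq (Sigma : seq spi) (i : spi) : Prop :=
  forall A : SLO, (forall s, s \in Sigma -> slo_valid A s) -> slo_valid A i.

Definition spi_logic (Sigma : seq spi) : spi -> Prop := slo_conseq Sigma.

Record frame : Type := {
  world : Type;
  frel : nat -> world -> world -> Prop
}.
Arguments frel : clear implicits.

Fixpoint kr_sat (F : frame) (V : nat -> world F -> Prop) (w : world F) (f : spf)
  : Prop :=
  match f with
  | SVar n => V n w
  | STop => True
  | SAnd a b => kr_sat V w a /\ kr_sat V w b
  | SDia r a => exists u : world F, frel F r w u /\ kr_sat V u a
  end.

Definition frame_valid (F : frame) (i : spi) : Prop :=
  forall (V : nat -> world F -> Prop) (w : world F), kr_sat V w i.1 -> kr_sat V w i.2.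

Definition kr_conseq (Sigma : seq spi) (i : spi) : Prop :=
  forall F : frame, (forall s, s \in Sigma -> frame_valid F s) -> frame_valid F i.

Definition complete (Sigma : seq spi) : Prop :=
  forall i : spi, kr_conseq Sigma i <-> slo_conseq Sigma i.

(* The complex algebra F^* : subsets of W (up to extensional equality),
   with intersection, W, and the diamonds Diamond_R^+. *)
Definition cx_dia (F : frame) (r : nat) (X : world F -> Prop) : world F -> Prop :=
  fun w => exists v, X v /\ frel F r w v.

Definition set_eq (W : Type) (X Y : W -> Prop) : Prop := forall w, X w <-> Y w.

Definition slo_embedding (A : SLO) (F : frame) (h : slo_car A -> world F -> Prop)
  : Prop :=
  [/\ (forall x y, set_eq (h x) (h y) -> x = y),
      (forall x y, set_eq (h (slo_meet x y)) (fun w => h x w /\ h y w)),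
      set_eq (h (slo_top A)) (fun _ => True) &
      (forall r x, set_eq (h (slo_dia r x)) (cx_dia r (h x)))].

Definition slo_validates_logic (A : SLO) (L : spi -> Prop) : Prop :=
  forall i, L i -> slo_valid A i.

Definition frame_validates_logic (F : frame) (L : spi -> Prop) : Prop :=
  forall i, L i -> frame_valid F i.

Definition complex (Sigma : seq spi) : Prop :=
  forall A : SLO, slo_validates_logic A (spi_logic Sigma) ->
    exists F : frame, frame_validates_logic F (spi_logic Sigma) /\
      exists h : slo_car A -> world F -> Prop, slo_embedding h.

Inductive prf : Type :=
| PZero : prf
| PSucc : prf
| PProj : nat -> prf
| PComp : prf -> seq prf -> prf
| PPrim : prf -> prf -> prf
| PMu : prf -> prf.

Inductive peval : prf -> seq nat -> nat -> Prop :=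
| ev_zero args : peval PZero args 0
| ev_succ x : peval PSucc [:: x] x.+1
| ev_proj i args : (i < size args)%N -> peval (PProj i) args (nth 0 args i)
| ev_comp f gs args ys y :
    pevals gs args ys -> peval f ys y -> peval (PComp f gs) args y
| ev_prim0 f g args y : peval f args y -> peval (PPrim f g) (0 :: args) y
| ev_primS f g n args r y :
    peval (PPrim f g) (n :: args) r -> peval g [:: n, r & args] y ->
    peval (PPrim f g) (n.+1 :: args) y
| ev_mu f args n :
    peval f (n :: args) 0 ->
    (forall m, (m < n)%N -> exists k, peval f (m :: args) k.+1) ->
    peval (PMu f) args n
with pevals : seq prf -> seq nat -> seq nat -> Prop :=
| evs_nil args : pevals [::] args [::]
| evs_cons g gs args y ys :
    peval g args y -> pevals gs args ys -> pevals (g :: gs) args (y :: ys).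

Definition rec_decidable (T : countType) (P : T -> Prop) : Prop :=
  exists p : prf, forall x : T,
    (P x -> peval p [:: pickle x] 1) /\ (~ P x -> peval p [:: pickle x] 0).

(* Main.v *)
(** A ground term over binary function symbols is read as an sp-formula in
    which a node labelled [k] is a conjunction of two diamonds leading to its children, and a fact
    "the machine reaches configuration [c]" is read as [T <= <0>c].  A root
    rewrite rule [l -> r] then is the sp-implication [<0>l -> <0>r].  To these we
    add [T -> <0>start], [<0>halt -> p] and [<1>p -> p].

    If the machine halts, every SLO of the logic is trivial, so the logic is
    complex and complete (the empty frame).  If it does not halt, take the
    powerset of the set of terms with [<0>] given by reachability, the term
    diamonds by the child relations, and [<1>X] equal to the whole set if [X] is
    the whole set and empty otherwise.  This SLO validates the axioms and refutes
    [p /\ <1>T -> <1>p]; but frames of [<1>p -> p] have [R_1] included in the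
    diagonal and so validate that implication.

    The machine is an interpreter for partial recursive functions, run on a
    purported decider composed with the function that computes the code of the
    whole axiom set from the code of the axioms without the initial one.
    Because a decider is total, only the forward simulation and determinism of
    the machine are needed. *)

Require Import Defs.
From Stdlib Require Import FunctionalExtensionality PropExtensionality.
From mathcomp Require Import all_boot.

Set Implicit Arguments.
Unset Strict Implicit.
Unset Printing Implicit Defensive.

(** * Root rewriting of terms *)

Inductive tm : Type := V of nat | L | N of nat & tm & tm.

Fixpoint inst (t : nat -> tm) (p : tm) : tm :=
  match p with
  | V i => t i
  | L => L
  | N k a b => N k (inst t a) (inst t b)
  end.

Fixpoint vars (p : tm) : seq nat :=
  match p with
  | V i => [:: i]
  | L => [::]
  | N _ a b => vars a ++ vars b
  end.

Definition rule : Type := (tm * tm)%type.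

Definition get_rule (rs : seq rule) (i : nat) : rule := nth (L, L) rs i.

Definition step (rs : seq rule) (c d : tm) : Prop :=
  exists i t, [/\ i < size rs, c = inst t (get_rule rs i).1
                             & d = inst t (get_rule rs i).2].

Inductive steps (rs : seq rule) : tm -> tm -> Prop :=
| steps_refl c : steps rs c c
| steps_cons c d e : step rs c d -> steps rs d e -> steps rs c e.

(** Linearity serves the matching in [tm_eval_match]; the inclusion makes the result of a root step
    depend only on the redex. *)
Definition wf_rule (r : rule) : bool :=
  uniq (vars r.1) && all (fun i => i \in vars r.1) (vars r.2).

Lemma inst_eq_in (t u : nat -> tm) (p : tm) :
  (forall i, i \in vars p -> t i = u i) -> inst t p = inst u p.
Proof.
elim: p => //= [i|k a IHa b IHb] E; first by apply: E; rewrite mem_head.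
by rewrite IHa ?IHb // => i ip; apply: E; rewrite mem_cat ip ?orbT.
Qed.

Lemma inst_inj_in (t u : nat -> tm) (p : tm) :
  inst t p = inst u p -> forall i, i \in vars p -> t i = u i.
Proof.
elim: p => //= [i|k a IHa b IHb] E j; first by rewrite inE => /eqP ->.
by case: E => Ea Eb; rewrite mem_cat => /orP[/(IHa Ea)|/(IHb Eb)].
Qed.

Lemma inst_V (p : tm) : inst V p = p.
Proof. by elim: p => //= k a -> b ->. Qed.

Lemma inst_closed (t : nat -> tm) (p : tm) : vars p = [::] -> inst t p = p.
Proof. by move=> cp; rewrite -[RHS]inst_V; apply: inst_eq_in; rewrite cp. Qed.

(** A computable over-approximation of unifiability, with variables renamed apart and repetitions
    ignored. *)
Fixpoint overlap (p q : tm) : bool :=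
  match p, q with
  | V _, _ | _, V _ | L, L => true
  | N k a b, N l c d => [&& k == l, overlap a c & overlap b d]
  | _, _ => false
  end.

Lemma overlapP (t u : nat -> tm) (p q : tm) :
  inst t p = inst u q -> overlap p q.
Proof.
elim: p q => [i|//|k a IHa b IHb] [j||l c d] //= [-> /IHa-> /IHb->].
by rewrite eqxx.
Qed.

Definition stuck (rs : seq rule) (c : tm) : bool :=
  all (fun r => ~~ overlap r.1 c) rs.

Definition deterministic (rs : seq rule) : bool :=
  pairwise (fun r s => ~~ overlap r.1 s.1) rs.

Lemma stuckP (rs : seq rule) (c d : tm) : stuck rs c -> ~ step rs c d.
Proof.
move=> /all_nthP st [i [t [lt_i Ec _]]].
by move: (st (L, L) i lt_i); rewrite -[c]inst_V in Ec; rewrite (overlapP (esym Ec)).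
Qed.

Lemma step_functional (rs : seq rule) (c d e : tm) :
  deterministic rs -> all wf_rule rs -> step rs c d -> step rs c e -> d = e.
Proof.
move=> /(pairwiseP (L, L)) det /all_nthP wf.
move=> [i [t [lt_i Ei ->]]] [j [u [lt_j Ej ->]]]; rewrite {c}Ei in Ej.
have [ltij|ltji|eij] := ltngtP i j.
- by move: (det i j lt_i lt_j ltij); rewrite (overlapP Ej).
- by move: (det j i lt_j lt_i ltji); rewrite (overlapP (esym Ej)).
rewrite -{}eij in Ej *; case/andP: (wf (L, L) i lt_i) => _ /allP sub.
by apply: inst_eq_in => k /sub; apply: inst_inj_in Ej k.
Qed.

Lemma steps_trans (rs : seq rule) (c d e : tm) :
  steps rs c d -> steps rs d e -> steps rs c e.
Proof. by elim=> // ? ? ? s _ IH /IH; apply: steps_cons. Qed.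

Lemma steps_stuck_unique (rs : seq rule) (c d e : tm) :
  deterministic rs -> all wf_rule rs -> stuck rs d -> stuck rs e ->
  steps rs c d -> steps rs c e -> d = e.
Proof.
move=> det wf std ste cd; elim: cd std => {c d} [c|c c' d s _ IH] std ce.
  by case: ce std => // x y z xy _ /stuckP /(_ xy).
apply: IH => //; case: ce ste s => [x /stuckP st /st //|x y z xy yz _ s].
by rewrite (step_functional det wf s xy).
Qed.

(** * The axiom system of a rewriting machine *)

(** Indices 0 and 1 are kept for reachability and the diagonal axiom. The leaf has its own diamond
    because plain top would match every term; from 3 on, parity separates left from right
    children. *)
Fixpoint fm (p : tm) : spf :=
  match p with
  | V i => SVar i
  | L => SDia 2 STop
  | N k a b => SAnd (SDia k.*2.+3 (fm a)) (SDia k.*2.+4 (fm b))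
  end.

Definition rule_ax (r : rule) : spi := (SDia 0 (fm r.1), SDia 0 (fm r.2)).

Definition start_ax (c : tm) : spi := (STop, SDia 0 (fm c)).

Definition diag_ax : spi := (SDia 1 (SVar 0), SVar 0).

Definition base (rs : seq rule) (h : tm) : seq spi :=
  [:: diag_ax, (SDia 0 (fm h), SVar 0) & [seq rule_ax r | r <- rs]].

Definition machine_axs (rs : seq rule) (h c : tm) : seq spi :=
  start_ax c :: base rs h.

Lemma rule_ax_in (rs : seq rule) (h c : tm) (i : nat) :
  i < size rs -> rule_ax (get_rule rs i) \in machine_axs rs h c.
Proof.
move=> lt_i; rewrite !inE -(nth_map _ (rule_ax (L, L))) //.
by rewrite mem_nth ?size_map // !orbT.
Qed.

Lemma slo_le_trans (A : SLO) (x y z : slo_car A) :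
  slo_le x y -> slo_le y z -> slo_le x z.
Proof. by rewrite /slo_le => xy yz; rewrite -xy -slo_meetA yz. Qed.

Definition tm_val (A : SLO) (c : tm) : slo_car A :=
  slo_eval (fun=> slo_top A) (fm c).

Lemma eval_fm_inst (A : SLO) (t : nat -> tm) (p : tm) :
  slo_eval (fun i => tm_val A (t i)) (fm p) = tm_val A (inst t p).
Proof. by elim: p => //= k a -> b ->. Qed.

(** The rule axioms carry [T <= <0>d] along the run; at [h], the axiom [<0>h -> p] with [p]
    arbitrary puts top below every element. *)
Lemma halt_trivial (rs : seq rule) (h c : tm) (A : SLO) :
  vars h = [::] -> steps rs c h ->
  (forall s, s \in machine_axs rs h c -> slo_valid A s) ->
  forall x : slo_car A, x = slo_top A.
Proof.
move=> clh run val x.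
have reach d : steps rs c d -> slo_le (slo_top A) (slo_dia 0 (tm_val A d)).
  move: (val _ (mem_head _ _) (fun=> slo_top A)); rewrite /= -/(tm_val A c).
  move=> h0 cd; elim: cd h0 => // {run}c' d' e [i [t [lt_i -> ->]]] _ IH h0.
  apply: IH; apply: slo_le_trans h0 _.
  move: (val _ (rule_ax_in h c lt_i) (fun i => tm_val A (t i))).
  by rewrite /= !eval_fm_inst.
have hx : slo_le (slo_dia 0 (tm_val A h)) x.
  have inS : (SDia 0 (fm h), SVar 0) \in machine_axs rs h c.
    by rewrite !inE eqxx !orbT.
  have := val _ inS (fun i => if i is 0 then x else slo_top A).
  suff -> : slo_eval (fun i => if i is 0 then x else slo_top A)
              (SDia 0 (fm h)) = slo_dia 0 (tm_val A h) by [].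
  (* The value of a closed term does not depend on the valuation. *)
  congr slo_dia; elim: h clh {run inS val reach} => //= k a IHa b IHb.
  by move/eqP; rewrite -size_eq0 size_cat addn_eq0 !size_eq0;
    case/andP=> /eqP /IHa -> /eqP /IHb ->.
have := slo_le_trans (reach _ run) hx.
by rewrite /slo_le slo_meetC slo_meetT.
Qed.

(** * Powerset algebras *)

Lemma pred_ext (W : Type) (X Y : W -> Prop) : (forall w, X w <-> Y w) -> X = Y.
Proof.
move=> E; apply: functional_extensionality => w.
exact: propositional_extensionality.
Qed.

Definition pow_SLO (W : Type) (dia : nat -> (W -> Prop) -> W -> Prop)
    (mono : forall r (X Y : W -> Prop),
        (forall w, X w -> Y w) -> forall w, dia r X w -> dia r Y w) : SLO.
Proof.
refine (@Build_SLO (W -> Prop) (fun X Y w => X w /\ Y w) (fun=> True) dia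
          _ _ _ _ _).
- by move=> X Y Z; apply: pred_ext => w; tauto.
- by move=> X Y; apply: pred_ext => w; tauto.
- by move=> X; apply: pred_ext => w; tauto.
- by move=> X; apply: pred_ext => w; tauto.
- move=> r X Y XY; apply: pred_ext => w; split=> [[]//|dX]; split=> //.
  by apply: mono dX => u; rewrite -XY => -[].
Defined.

Lemma pow_SLO_le (W : Type) (dia : nat -> (W -> Prop) -> W -> Prop) mono
    (X Y : W -> Prop) :
  @slo_le (@pow_SLO W dia mono) X Y <-> forall w, X w -> Y w.
Proof.
split=> [E w|sub]; first by rewrite -E => -[].
apply: pred_ext => w; by split=> [[]//|Xw]; split=> //; apply: sub.
Qed.

Lemma frame_dia_mono (F : frame) (r : nat) (X Y : world F -> Prop) :
  (forall w, X w -> Y w) ->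
  forall w, (exists u, Defs.frel F r w u /\ X u) -> exists u, Defs.frel F r w u /\ Y u.
Proof. by move=> sub w [u [Ru /sub Yu]]; exists u. Qed.

Definition frame_SLO (F : frame) : SLO := pow_SLO (@frame_dia_mono F).

Lemma frame_SLO_valid (F : frame) (i : spi) :
  slo_valid (frame_SLO F) i <-> frame_valid F i.
Proof.
have evE (v : nat -> world F -> Prop) f w :
    @slo_eval (frame_SLO F) v f w <-> kr_sat v w f.
  elim: f w => //= [a IHa b IHb|r a IHa] w; first by rewrite IHa IHb.
  by split=> -[u [Ru /IHa au]]; exists u.
split=> val v.
  by have /pow_SLO_le sub := val v; move=> w /evE /sub /evE.
by apply/pow_SLO_le => w /evE /val /evE.
Qed.

(** * Halting and completeness *)

Lemma complete_complex_of_trivial (Sigma : seq spi) :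
  (forall A : SLO, (forall s, s \in Sigma -> slo_valid A s) ->
     forall x : slo_car A, x = slo_top A) ->
  complete Sigma /\ complex Sigma.
Proof.
move=> triv; split=> [i|A AL].
  split=> [_ A /triv At v|con F Fval].
    by rewrite /slo_le (At (slo_meet _ _)); exact/esym/At.
  by apply/frame_SLO_valid/con => s /Fval /frame_SLO_valid.
have At : forall x : slo_car A, x = slo_top A.
  by apply: triv => s sS; apply: AL => B; exact.
exists (Build_frame (fun _ (x y : False) => True)); split; first by move=> i _ v [].
by exists (fun _ _ => False); split=> [x y _|x y []|[]|r x []]; rewrite (At x) (At y).
Qed.

Definition diag_test : spi :=
  (SAnd (SVar 0) (SDia 1 STop), SDia 1 (SVar 0)).

Lemma frame_diag (F : frame) :
  frame_valid F diag_ax -> forall w u, Defs.frel F 1 w u -> w = u.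
Proof. by move=> val w u wu; apply: (val (fun _ x => x = u)); exists u. Qed.

Lemma not_complete_complex (Sigma : seq spi) (A : SLO) :
  diag_ax \in Sigma -> (forall s, s \in Sigma -> slo_valid A s) ->
  ~ slo_valid A diag_test -> ~ complete Sigma /\ ~ complex Sigma.
Proof.
move=> dS AS Adt; split=> [/(_ diag_test)[con _]|cx].
  apply: Adt; apply: con => // F /(_ _ dS) /frame_diag Fd v w /= [vw [u [wu _]]].
  by exists u; split=> //; rewrite -(Fd _ _ wu).
have [|F [FL [h [inj meet top dia]]]] := cx A; first by move=> i; apply.
have /frame_diag Fd : frame_valid F diag_ax.
  by apply: FL => B; apply.
(* An inequality is an equation between meets, so injectivity of [h] lets it be checked in [F],
   where relation 1 lies in the diagonal. *)
apply: Adt => v; apply: inj => w /=; split=> [/meet[]//|xw]; apply/meet; split=> //.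
have [vw /dia[u [_ wu]]] := (meet _ _ _).1 xw.
by apply/dia; exists u; split=> //; rewrite -(Fd _ _ wu).
Qed.

(** Indices are those of [fm] lowered by two. At [L], relation 0 leads to every term, so [<2>T]
    holds exactly at [L]. *)
Definition child (r : nat) (c d : tm) : Prop :=
  match c with
  | V _ => False
  | L => r = 0
  | N k a b => r = k.*2.+1 /\ d = a \/ r = k.*2.+2 /\ d = b
  end.

Definition tm_dia (reach : tm -> Prop) (r : nat) (X : tm -> Prop) (c : tm) : Prop :=
  match r with
  | 0 => exists d, reach d /\ X d
  | 1 => forall d, X d
  | s.+2 => exists d, child s c d /\ X d
  end.

Lemma tm_dia_mono (reach : tm -> Prop) (r : nat) (X Y : tm -> Prop) :
  (forall c, X c -> Y c) -> forall c, tm_dia reach r X c -> tm_dia reach r Y c.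
Proof.
by case: r => [|[|r]] sub c /= => [[d [rd /sub]]|all d|[d [rd /sub]]];
  [exists d|apply: sub|exists d].
Qed.

Definition tm_SLO (reach : tm -> Prop) : SLO := pow_SLO (@tm_dia_mono reach).

Lemma tm_eval_inst reach (v : nat -> tm -> Prop) (t : nat -> tm) (p : tm) :
  (forall i, i \in vars p -> v i (t i)) ->
  @slo_eval (tm_SLO reach) v (fm p) (inst t p).
Proof.
elim: p => /= [i||k a IHa b IHb] vt; first by apply: vt; rewrite mem_head.
  by exists L.
split; [exists (inst t a)|exists (inst t b)]; split; do ?[by left|by right].
- by apply: IHa => i ia; apply: vt; rewrite mem_cat ia.
- by apply: IHb => i ib; apply: vt; rewrite mem_cat ib orbT.
Qed.

(* Linearity of the pattern is what lets the matches of the two subpatterns be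
   glued: a valuation is an arbitrary set, so two occurrences of a variable
   could match different terms. *)
Lemma tm_eval_match reach (v : nat -> tm -> Prop) (p d : tm) :
  uniq (vars p) -> @slo_eval (tm_SLO reach) v (fm p) d ->
  exists2 t, d = inst t p & forall i, i \in vars p -> v i (t i).
Proof.
elim: p d => /= [i||k a IHa b IHb] d.
- by move=> _ vd; exists (fun=> d) => // j; rewrite inE => /eqP ->.
- by case: d => [j||j d1 d2] _ [e [/= E _]]; [|exists V|case: E => -[]].
rewrite cat_uniq => /and3P[ua /hasPn dis ub].
case: d => [j|/=|j d1 d2] [[e1 [/= E1 S1]] [e2 [/= E2 S2]]] //.
have odd_even m n : m.*2.+1 = n.*2.+2 -> False.
  by move/(congr1 odd); rewrite /= !odd_double.
case: E1 => [[[/double_inj Ek E1]]|[/odd_even //]]; subst j e1.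
case: E2 => [[/esym/odd_even //]|[_ ?]]; subst e2.
have [t1 -> v1] := IHa _ ua S1; have [t2 -> v2] := IHb _ ub S2.
pose t i := if i \in vars a then t1 i else t2 i.
exists t.
  congr N; apply: inst_eq_in => i ip; rewrite /t ?ip //.
  by rewrite (negPf (dis i ip)).
move=> i; rewrite mem_cat /t; case: ifP => [ia _|_]; [exact: v1|exact: v2].
Qed.

Lemma nonhalt_model (rs : seq rule) (h c : tm) :
  all wf_rule rs -> vars h = [::] -> vars c = [::] -> ~ steps rs c h ->
  let A := tm_SLO (steps rs c) in
  (forall s, s \in machine_axs rs h c -> slo_valid A s) /\ ~ slo_valid A diag_test.
Proof.
move=> /all_nthP wf clh clc nh A; split; last first.
  (* With [p] the singleton of [L], the premise holds at [L], while the conclusion would put [V 0]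
     into [p]. *)
  move=> /(_ (fun _ d => d = L)) /pow_SLO_le /= H.
  by have := H L (conj erefl (fun=> I)) (V 0).
move=> s; rewrite !inE => /or4P[/eqP->|/eqP->|/eqP->|sR] v; apply/pow_SLO_le.
- move=> w _; exists c; split; first exact: steps_refl.
  by rewrite -[X in _ X]inst_V; apply: tm_eval_inst => i; rewrite clc.
- by move=> w; exact.
- move=> w [d [rd]] /tm_eval_match[|t Ed _]; first by rewrite clh.
  by rewrite Ed inst_closed in rd.
case/(nthP (rule_ax (L, L))): sR => i; rewrite size_map => lt_i.
rewrite (nth_map (L, L)) // => <- w [d [rd]].
have /andP[lin sub] := wf (L, L) i lt_i.
move=> /(tm_eval_match lin)[t Ed vt].
exists (inst t (get_rule rs i).2); split.
  by apply: steps_trans rd _; apply: steps_cons (steps_refl _ _); exists i, t.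
by apply: tm_eval_inst => j /(allP sub) /vt.
Qed.

(** * An interpreter for partial recursive functions *)

Definition tS (x : tm) : tm := N 0 x L.
Definition tcons (x l : tm) : tm := N 1 x l.
Definition num (n : nat) : tm := iter n tS L.
Definition tlist (s : seq tm) : tm := foldr tcons L s.
Definition nums (s : seq nat) : tm := tlist (map num s).

(** Rewriting acts only at the root, so a continuation [k] makes the evaluation order explicit.
    Labels are shared between sorts; the position within a configuration tells them apart. *)
Definition ev (p a k : tm) : tm := N 0 p (N 0 a k).
Definition ret (v k : tm) : tm := N 1 v k.
Definition evs (gs a k : tm) : tm := N 2 gs (N 0 a k).
Definition rets (vs k : tm) : tm := N 3 vs k.
Definition search (f n a k : tm) : tm := N 4 (N 0 f n) (N 0 a k).
Definition start (x : tm) : tm := N 5 x L.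

Definition tsucc : tm := N 0 L L.
Definition tproj (i : tm) : tm := N 1 i L.
Definition tcomp (f gs : tm) : tm := N 2 f gs.
Definition tprim (f g : tm) : tm := N 3 f g.
Definition tmu (f : tm) : tm := N 4 f L.

Fixpoint prog (p : prf) : tm :=
  match p with
  | PZero => L
  | PSucc => tsucc
  | PProj i => tproj (num i)
  | PComp f gs => tcomp (prog f) (tlist (map prog gs))
  | PPrim f g => tprim (prog f) (prog g)
  | PMu f => tmu (prog f)
  end.

Definition kcomp (f k : tm) : tm := N 0 f k.
Definition karg (gs a k : tm) : tm := N 1 (N 0 gs a) k.
Definition kval (y k : tm) : tm := N 2 y k.
Definition kprim (g n a k : tm) : tm := N 3 (N 0 g n) (N 0 a k).
Definition kmu (f n a k : tm) : tm := N 4 (N 0 f n) (N 0 a k).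

(* The numbers are the indices passed to [run] in the simulation proof. *)
Definition rules (P : tm) : seq rule :=
  let: (x0, x1, x2, x3, x4) := (V 0, V 1, V 2, V 3, V 4) in
  [:: (* 0 *) (start x0, ev P (tcons x0 L) L);
      (* 1 *) (ev L x0 x1, ret L x1);
      (* 2 *) (ev tsucc (tcons x0 L) x1, ret (tS x0) x1);
      (* 3 *) (ev (tproj L) (tcons x0 x1) x2, ret x0 x2);
      (* 4 *) (ev (tproj (tS x3)) (tcons x0 x1) x2, ev (tproj x3) x1 x2);
      (* 5 *) (ev (tcomp x0 x1) x2 x3, evs x1 x2 (kcomp x0 x3));
      (* 6 *) (evs L x0 x1, rets L x1);
      (* 7 *) (evs (tcons x0 x1) x2 x3, ev x0 x2 (karg x1 x2 x3));
      (* 8 *) (ret x0 (karg x1 x2 x3), evs x1 x2 (kval x0 x3));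
      (* 9 *) (rets x0 (kval x1 x2), rets (tcons x1 x0) x2);
      (* 10 *) (rets x0 (kcomp x1 x2), ev x1 x0 x2);
      (* 11 *) (ev (tprim x0 x1) (tcons L x2) x3, ev x0 x2 x3);
      (* 12 *) (ev (tprim x0 x1) (tcons (tS x2) x3) x4,
                ev (tprim x0 x1) (tcons x2 x3) (kprim x1 x2 x3 x4));
      (* 13 *) (ret x0 (kprim x1 x2 x3 x4), ev x1 (tcons x2 (tcons x0 x3)) x4);
      (* 14 *) (ev (tmu x0) x1 x2, search x0 L x1 x2);
      (* 15 *) (search x0 x1 x2 x3, ev x0 (tcons x1 x2) (kmu x0 x1 x2 x3));
      (* 16 *) (ret L (kmu x0 x1 x2 x3), ret x1 x3);
      (* 17 *) (ret (tS x4) (kmu x0 x1 x2 x3), search x0 (tS x1) x2 x3)].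

(** [L] is both the numeral 0 and the empty continuation, so halting means answering 0. *)
Definition halt : tm := ret L L.

Lemma vars_num (n : nat) : vars (num n) = [::].
Proof. by elim: n => //= n ->. Qed.

Lemma vars_prog : forall p : prf, vars (prog p) = [::].
Proof.
fix IH 1 => -[||i|f gs|f g|f] //=.
- by rewrite vars_num.
- rewrite IH /=; elim: gs => //= g gs IHs; by rewrite IH IHs.
- by rewrite IH IH.
- by rewrite IH.
Qed.

Lemma rules_wf (p : prf) : all wf_rule (rules (prog p)).
Proof. by rewrite /= {1}/wf_rule /= vars_prog. Qed.

(** No left-hand side mentions [P], so the check computes with [P] abstract. *)
Lemma rules_det (P : tm) : deterministic (rules P).
Proof. by []. Qed.

(** Performs one step in a goal; [s] lists the values of [V 0], [V 1], and so on. *)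
Lemma run (P : tm) (i : nat) (s : seq tm) (d : tm) :
  i < size (rules P) ->
  steps (rules P) (inst (nth L s) (get_rule (rules P) i).2) d ->
  steps (rules P) (inst (nth L s) (get_rule (rules P) i).1) d.
Proof. by move=> lt_i; apply: steps_cons; exists i, (nth L s). Qed.

Fixpoint peval_steps P p a y (H : peval p a y) {struct H} : forall k,
  steps (rules P) (ev (prog p) (nums a) k) (ret (num y) k)
with pevals_steps P gs a ys (H : pevals gs a ys) {struct H} : forall k,
  steps (rules P) (evs (tlist (map prog gs)) (nums a) k) (rets (nums ys) k).
Proof.
- case: {p a y} H.
  + by move=> a k; apply: (@run P 1 [:: nums a; k]) => //; apply: steps_refl.
  + by move=> x k; apply: (@run P 2 [:: num x; k]) => //; apply: steps_refl.
  + move=> i a lt_i k; elim: a i lt_i => [|x a IH] [|i] //= lt_i.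
      by apply: (@run P 3 [:: num x; nums a; k]) => //; apply: steps_refl.
    by apply: (@run P 4 [:: num x; nums a; k; num i]) => //; apply: IH.
  + move=> f gs a ys y Hgs Hf k.
    apply: (@run P 5 [:: prog f; tlist (map prog gs); nums a; k]) => //.
    apply: steps_trans (pevals_steps P _ _ _ Hgs _) _.
    apply: (@run P 10 [:: nums ys; prog f; k]) => //.
    exact: (peval_steps P _ _ _ Hf).
  + move=> f g a y Hf k.
    apply: (@run P 11 [:: prog f; prog g; nums a; k]) => //.
    exact: (peval_steps P _ _ _ Hf).
  + move=> f g n a r y Hr Hg k.
    apply: (@run P 12 [:: prog f; prog g; num n; nums a; k]) => //.
    apply: steps_trans (peval_steps P _ _ _ Hr _) _.
    apply: (@run P 13 [:: num r; prog g; num n; nums a; k]) => //.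
    exact: (peval_steps P _ _ _ Hg).
  + move=> f a n H0 Hlt k.
    have pos m : m < n -> exists j, forall k,
        steps (rules P) (ev (prog f) (nums (m :: a)) k) (ret (num j.+1) k).
      move=> lt_m; case: (Hlt m lt_m) => j Hj; exists j.
      exact: (peval_steps P _ _ _ Hj).
    have zero := peval_steps P _ _ _ H0.
    apply: (@run P 14 [:: prog f; nums a; k]) => //.
    (* [m] counts the candidates left before the least zero [n], so the induction goes backwards
       from [n]. *)
    suff loop m : m <= n ->
        steps (rules P) (search (prog f) (num (n - m)) (nums a) k) (ret (num n) k).
      by move: (loop n); rewrite subnn; apply.
    elim: m => [_|m IH lt_m].
      rewrite subn0; apply: (@run P 15 [:: prog f; num n; nums a; k]) => //.
      apply: steps_trans (zero _) _.
      apply: (@run P 16 [:: prog f; num n; nums a; k]) => //; exact: steps_refl.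
    apply: (@run P 15 [:: prog f; num (n - m.+1); nums a; k]) => //.
    have [|j Hj] := pos (n - m.+1); first by rewrite ltn_subrL (leq_ltn_trans _ lt_m).
    apply: steps_trans (Hj _) _.
    apply: (@run P 17 [:: prog f; num (n - m.+1); nums a; k; num j]) => //.
    by rewrite -[n - m]subSS subSn in IH; last exact: lt_m; apply: IH; apply: ltnW.
- case: {gs a ys} H.
  + by move=> a k; apply: (@run P 6 [:: nums a; k]) => //; apply: steps_refl.
  + move=> g gs a y ys Hg Hgs k.
    apply: (@run P 7 [:: prog g; tlist (map prog gs); nums a; k]) => //.
    apply: steps_trans (peval_steps P _ _ _ Hg _) _.
    apply: (@run P 8 [:: num y; tlist (map prog gs); nums a; k]) => //.
    apply: steps_trans (pevals_steps P _ _ _ Hgs _) _.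
    by apply: (@run P 9 [:: nums ys; num y; k]) => //; apply: steps_refl.
Qed.

Definition prog_axs (p : prf) (n : nat) : seq spi :=
  machine_axs (rules (prog p)) halt (start (num n)).

Lemma start_steps (p : prf) (n y : nat) : peval p [:: n] y ->
  steps (rules (prog p)) (start (num n)) (ret (num y) L).
Proof.
move=> Hp; apply: (@run _ 0 [:: num n]) => //=.
by rewrite inst_closed ?vars_prog //; apply: (peval_steps _ Hp).
Qed.

Lemma prog_axs_0 (p : prf) (n : nat) : peval p [:: n] 0 ->
  complete (prog_axs p n) /\ complex (prog_axs p n).
Proof.
move=> Hp; apply: complete_complex_of_trivial => A.
exact: (halt_trivial (h := halt) (erefl _) (start_steps Hp)).
Qed.

Lemma prog_axs_S (p : prf) (n y : nat) : peval p [:: n] y.+1 ->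
  ~ complete (prog_axs p n) /\ ~ complex (prog_axs p n).
Proof.
move=> /start_steps Hp.
have [|||A_val A_test] := @nonhalt_model _ halt (start (num n)) (rules_wf p).
- by [].
- by rewrite /= vars_num.
- move=> Hh.
  (* [halt] and the return of a successor are distinct stuck configurations, so one run cannot reach
     both. *)
  by have /(_ isT isT) := steps_stuck_unique (rules_det _) (rules_wf p) _ _ Hp Hh.
apply: not_complete_complex A_val A_test.
by rewrite !inE eqxx orbT.
Qed.

(** * Computing the code of the axiom system *)

Definition computable (f : nat -> nat) : Prop :=
  exists p, forall x, peval p [:: x] (f x).

Lemma computable_ext (f g : nat -> nat) :
  f =1 g -> computable f -> computable g.
Proof. by move=> E [p Hp]; exists p => x; rewrite -E. Qed.

Lemma computable_id : computable id.
Proof. by exists (PProj 0) => x; apply: (@ev_proj 0 [:: x]). Qed.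

Lemma computable_comp (f g : nat -> nat) :
  computable f -> computable g -> computable (fun x => f (g x)).
Proof.
move=> [p Hp] [q Hq]; exists (PComp p [:: q]) => x.
by apply: ev_comp (Hp _); apply: evs_cons (Hq x) (evs_nil _).
Qed.

Lemma computable_succ : computable S.
Proof. by exists PSucc; apply: ev_succ. Qed.

Lemma computable_const (c : nat) : computable (fun=> c).
Proof.
elim: c => [|c IH]; first by exists PZero => x; apply: ev_zero.
exact: computable_comp computable_succ IH.
Qed.

Lemma computable_iter (h m s : nat -> nat) :
  computable h -> computable m -> computable s ->
  computable (fun x => iter (m x) h (s x)).
Proof.
move=> [p Hp] [q Hq] [r Hr].
(* The step function of [PPrim] receives the counter first and the previous value second, hence
   [PProj 1]. *)
exists (PComp (PPrim (PProj 0) (PComp p [:: PProj 1])) [:: q; r]) => x.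
apply: ev_comp (evs_cons (Hq x) (evs_cons (Hr x) (evs_nil _))) _.
elim: (m x) => [|n IH] /=; first exact/ev_prim0/(@ev_proj 0 [:: s x]).
apply: ev_primS IH _; apply: ev_comp (Hp _).
by apply: evs_cons (evs_nil _); apply: (@ev_proj 1 [:: _; _; _]).
Qed.

Lemma computable_double : computable double.
Proof.
apply: (@computable_ext (fun x => iter x (fun y => y.+2) 0)).
  by elim=> //= n ->.
apply: computable_iter computable_id (computable_const 0).
exact: computable_comp computable_succ computable_succ.
Qed.

(** In [CodeSeq.code] this number codes the list with head [m x] and tail coded by [s x]. *)
Lemma computable_code_cons (m s : nat -> nat) :
  computable m -> computable s ->
  computable (fun x => 2 ^ m x * (s x).*2.+1).
Proof.
move=> cm cs.
apply: (@computable_ext (fun x => iter (m x) double (s x).*2.+1)) => [x|].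
  by elim: (m x) => [|n /= ->]; rewrite ?mul1n // expnS -mulnA mul2n.
apply: computable_iter computable_double cm _.
exact: computable_comp computable_succ (computable_comp computable_double cs).
Qed.

Definition code_cat (l : seq nat) (y : nat) : nat :=
  foldr (fun n m => 2 ^ n * m.*2.+1) y l.

Lemma code_catE (l s : seq nat) :
  CodeSeq.code (l ++ s) = code_cat l (CodeSeq.code s).
Proof. exact: foldr_cat. Qed.

Lemma computable_code_cat (l : seq nat) (s : nat -> nat) :
  computable s -> computable (fun x => code_cat l (s x)).
Proof.
move=> cs; elim: l => [|n l IH] //.
exact: computable_code_cons (computable_const n) IH.
Qed.

(** The bracket string behind [pickle]: node [i] opens with [tok i.+1] and closes with [tok 0], so
    [tok 3] opens a conjunction and [tok 4] a diamond. *)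
Definition enc (f : spf) : seq nat :=
  [seq pickle x | x <- GenTree.encode (spf_to_tree f)].

Definition tok (n : nat) : nat := pickle (inl n : nat + nat).
Definition leaf_tok (n : nat) : nat := pickle (inr n : nat + nat).

Lemma enc_and (f g : spf) : enc (SAnd f g) = tok 3 :: enc f ++ enc g ++ [:: tok 0].
Proof. by rewrite /enc /= cats0 map_rcons -cats1 map_cat catA. Qed.

Lemma enc_dia (r : nat) (f : spf) :
  enc (SDia r f) = [:: tok 4, leaf_tok r & enc f ++ [:: tok 0]].
Proof. by rewrite /enc /= cats0 map_rcons -cats1. Qed.

Definition node_pre (k : nat) : seq nat := [:: tok 3; tok 4; leaf_tok k.*2.+3].
Definition node_post (k : nat) : seq nat :=
  tok 0 :: enc (SDia k.*2.+4 (fm L)) ++ [:: tok 0].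

Lemma enc_fm_node (k : nat) (a : tm) :
  enc (fm (N k a L)) = node_pre k ++ enc (fm a) ++ node_post k.
Proof.
rewrite [fm _]/= enc_and [enc (SDia k.*2.+3 _)]enc_dia /node_pre /node_post.
by rewrite !cat_cons cat0s -!catA.
Qed.

(** A numeral is written as [n] equal prefixes, the leaf and [n] equal suffixes, so two nested
    iterations produce its code. *)
Lemma code_enc_num (n : nat) (s : seq nat) :
  CodeSeq.code (enc (fm (num n)) ++ s) =
  iter n (code_cat (node_pre 0))
    (code_cat (enc (fm L)) (iter n (code_cat (node_post 0)) (CodeSeq.code s))).
Proof.
elim: n s => [|n IH] s; first by rewrite code_catE.
rewrite [num _]iterS enc_fm_node -!catA code_catE IH code_catE.
(* Abstracting the code operations keeps conversion from evaluating them. *)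
move: (code_cat (node_pre 0)) (code_cat (node_post 0)) (code_cat (enc (fm L))).
by move=> f g h; rewrite -iterSr -iterS.
Qed.

Lemma pickle_spf (f : spf) : pickle f = CodeSeq.code (enc f).
Proof. by []. Qed.

Lemma pickle_spi (f g : spf) :
  pickle ((f, g) : spi) = CodeSeq.code [:: pickle f; pickle g].
Proof. by []. Qed.

Lemma pickle_spi_cons (i : spi) (s : seq spi) (n : nat) :
  pickle s = n -> pickle (i :: s) = 2 ^ pickle i * n.*2.+1.
Proof. by move=> <-. Qed.

Lemma computable_pickle_spi (f : spf) (g : nat -> spf) :
  computable (fun n => pickle (g n)) ->
  computable (fun n => pickle ((f, g n) : spi)).
Proof.
move=> cg; apply: (computable_ext (fun n => esym (pickle_spi f (g n)))).
apply: computable_code_cons; first exact: computable_const.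
exact: computable_code_cons cg (computable_const 0).
Qed.

Lemma computable_code_num (l s : seq nat) :
  computable (fun n => CodeSeq.code (l ++ enc (fm (num n)) ++ s)).
Proof.
apply: (computable_ext (fun n => esym (code_catE l _))).
apply: computable_code_cat.
apply: (computable_ext (fun n => esym (code_enc_num n s))).
move: (node_pre 0) (node_post 0) (enc (fm L)) => pre post mid.
have cc k : computable (code_cat k) := computable_code_cat k computable_id.
apply: computable_iter (cc _) computable_id _; apply: computable_code_cat.
exact: computable_iter (cc _) computable_id (computable_const _).
Qed.

Lemma computable_pickle_start :
  computable (fun n => pickle (start_ax (start (num n)))).
Proof.
apply: computable_pickle_spi.
pose l := [:: tok 4; leaf_tok 0] ++ node_pre 5.
pose s := node_post 5 ++ [:: tok 0].
have E n : enc (SDia 0 (fm (start (num n)))) = l ++ enc (fm (num n)) ++ s.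
  by rewrite enc_dia enc_fm_node /l /s -!catA.
apply: computable_ext (computable_code_num l s) => n.
by rewrite pickle_spf E.
Qed.

Lemma pickle_prog_axs (p : prf) (n : nat) :
  pickle (base (rules (prog p)) halt) = n ->
  pickle (prog_axs p n) = 2 ^ pickle (start_ax (start (num n))) * n.*2.+1.
Proof. exact: pickle_spi_cons. Qed.

(* [pickle (base ...)] serves as the input [n]: prepending the initial axiom for
   that input to the base is an arithmetic operation on the two codes. *)
Lemma undecidable_by_diagonal (Q : seq spi -> Prop) :
  (forall p n, peval p [:: n] 0 -> Q (prog_axs p n)) ->
  (forall p n, peval p [:: n] 1 -> ~ Q (prog_axs p n)) ->
  ~ rec_decidable Q.
Proof.
move=> Q0 Q1 [p Hp].
have [q Hq] := computable_code_cons computable_pickle_start computable_id.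
pose d := PComp p [:: q].
(* An opaque [e]: unfolding this code during unification does not terminate in
   practice. *)
have [e Ee] : exists e, pickle (base (rules (prog d)) halt) = e.
  by exists (pickle (base (rules (prog d)) halt)).
have run_d y : peval p [:: pickle (prog_axs d e)] y -> peval d [:: e] y.
  by rewrite (pickle_prog_axs Ee); apply/ev_comp/evs_cons/evs_nil/Hq.
(* If [Q] held, the answer 1 would refute it; so [Q] fails, and the answer 0 then makes it hold. No
   excluded middle is involved. *)
have nQ : ~ Q (prog_axs d e).
  by move=> HQ; apply: Q1 (HQ); apply: run_d; apply: (Hp _).1.
by apply: (nQ); apply: Q0; apply: run_d; apply: (Hp _).2.
Qed.

Theorem theorem8p1 :
  ~ rec_decidable (fun Sigma : seq spi => complete Sigma) /\
  ~ rec_decidable (fun Sigma : seq spi => complex Sigma).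
Proof.
split; apply: undecidable_by_diagonal => p n H.
- exact: (prog_axs_0 H).1.
- exact: (prog_axs_S H).1.
- exact: (prog_axs_0 H).2.
- exact: (prog_axs_S H).2.
Qed.
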